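(* Suppose $\mu,\nu$ are Borel probability measures on disjoint compact sets $E,F\subset\mathbb{R}^2$ respectively, such that $\mu(l)=\nu(l)=0$ for every line $l\subset\mathbb{R}^2$, and there exist $s_\mu,s_\nu\in(0,2]$ and $c_\mu,c_\nu>0$ such that for every $x\in\mathbb{R}^2$ and $r>0$, $$\mu(B(x,r))\leq c_\mu r^{s_\mu},\qquad \nu(B(x,r))\leq c_\nu r^{s_\nu}.$$ Then there exist $\kappa=\kappa(s_\mu,s_\nu)>0$ (depending only on $s_\mu,s_\nu$), a compact set $G\subset E\times F$ with $(\mu\times\nu)(G)>0$, and a constant $C=C(\mu,\nu)>0$, such that for every $(x,y)\in G$ the line $l_{x,y}$ satisfies $$\mu\left(T(l_{x,y},r)\right)\leq Cr^\kappa\quad\text{and}\quad\nu\left(T(l_{x,y},r)\right)\leq Cr^\kappa\qquad\text{for all }r>0.$$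
   Context: $B(x,r)$ is the ball of center $x$ and radius $r$. For distinct $x,y\in\mathbb{R}^2$, $l_{x,y}$ is the line through $x$ and $y$, and for a line $l$, $T(l,r)$ denotes the $r$-neighborhood of $l$. *)

(* Defs.v *)
From HB Require Import structures.
From mathcomp Require Import all_boot all_order all_algebra.
From mathcomp Require Import all_classical all_reals all_analysis.

Set Implicit Arguments.
Unset Strict Implicit.
Unset Printing Implicit Defensive.

Import Order.TTheory GRing.Theory Num.Theory.
Import numFieldNormedType.Exports.

Local Open Scope classical_set_scope.
Local Open Scope ring_scope.

(* The plane is the product R * R: its topology is the product topology and its
   sigma-algebra is the product of the Borel sigma-algebras of R, which is the
   Borel sigma-algebra of the plane.  The library's [ball] and norm on R * R are
   those of the sup norm, hence the Euclidean versions below. *)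

Definition edist (R : realType) (p q : R * R) : R :=
  Num.sqrt ((p.1 - q.1) ^+ 2 + (p.2 - q.2) ^+ 2).

Definition eball (R : realType) (x : R * R) (r : R) : set (R * R) :=
  [set p | edist x p < r].

(* Only meaningful for x <> y; it is [set x] when x = y. *)
Definition line_through (R : realType) (x y : R * R) : set (R * R) :=
  [set p | exists t : R,
     p = (x.1 + t * (y.1 - x.1), x.2 + t * (y.2 - x.2))].

Definition is_line (R : realType) (l : set (R * R)) : Prop :=
  exists x y : R * R, x <> y /\ l = line_through x y.

Definition tube (R : realType) (l : set (R * R)) (r : R) : set (R * R) :=
  [set p | exists q, l q /\ edist p q < r].

(* Main.v *)
Require Import Defs.
From HB Require Import structures.
From mathcomp Require Import all_boot all_order all_algebra.
From mathcomp Require Import all_classical all_reals all_analysis.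
From mathcomp Require Import ring lra.
Set Implicit Arguments.
Unset Strict Implicit.
Unset Printing Implicit Defensive.
Import Order.TTheory GRing.Theory Num.Theory.
Import numFieldNormedType.Exports.
Local Open Scope classical_set_scope.
Local Open Scope ring_scope.

(** The proof controls tubes along a sequence of scales d_0 > d_1 > ... with
    d_(k+1) = d_k ^ (5/4), against thresholds m_k: a pair (x, y) is good at
    scale k when the tube of width d_k around l_(x,y) has mass at most m_k for
    both measures.  The set G consists of the pairs of E * F that survive the
    removal of an open set W_k of small mass at each step, and survivors are
    good at all scales.

    Start.  Lines are null and E * F is compact, so for every eps there is a
    width below which all tubes around lines l_(x,y) have mass at most eps
    ([thin_tubes_uniform]).  This width is not controlled in terms of eps.

    Step ([heavy_tubes_cover]).  Among the pairs which are good at scale k but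
    whose d_(k+1)-tube is heavy for one of the measures, say P, choose a family
    greedily so that no chosen pair lies in V x V for V the d_k-tube of an
    earlier one.  If one of two points of a line is at distance at least d_k
    from another line, the two lines make an angle of order at least d_k, so
    that their d_(k+1)-tubes meet in a set of diameter O(d_(k+1) / d_k)
    ([tubes_inter_diam]); by the ball condition its P-measure is negligible
    compared with m_(k+1) ^ 2.  Heavy sets that are almost disjoint are few:
    the family has at most 3 / m_(k+1) members ([greedy_cover]).  Being maximal,
    it covers all the pairs in question by the products V x V, and each of
    these has mass at most m_k ^ 2 because the pair that defines V is good at
    scale k.  So mass at most 3 * m_k ^ 2 / m_(k+1) is lost.

    Thresholds ([exists_scales]).  The losses are summable if
    m_(k+1) >= m_k ^ (3/2) and m_0 is small, and the overlaps are negligible if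
    m_k >= d_k ^ tau with tau a small multiple of the exponent s of the ball
    condition.  Since 3/2 > 5/4, thresholds which start from m_0 = eps can decay
    faster than powers of d_k, until they meet d_k ^ tau, which they then
    follow.  Hence m_k <= C * d_k ^ tau although m_0 may be much larger than
    d_0 ^ tau: the lack of control at the start costs only the constant C, and
    the final exponent depends only on s. *)

(* The analysis library has its own [edist], with values in the extended
   reals, which hides the Euclidean distance. *)
Local Notation edist := Defs.edist.

(** * Lines, tubes and the cross product *)

Section Plane.
Context {R : realType}.
Implicit Types (p q x y u v : R * R) (r M d D : R).

(** Up to sign, the distance from [p] to the line through [x] and [y] times
    [edist x y].  It is polynomial in [x], [y] and [p]. *)
Definition cross x y p : R :=
  (y.1 - x.1) * (p.2 - x.2) - (y.2 - x.2) * (p.1 - x.1).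

Lemma edist_sqr p q : edist p q ^+ 2 = (p.1 - q.1) ^+ 2 + (p.2 - q.2) ^+ 2.
Proof. by rewrite /edist sqr_sqrtr // addr_ge0 // sqr_ge0. Qed.

Lemma edistC p q : edist p q = edist q p.
Proof. by rewrite /edist; congr (Num.sqrt _); ring. Qed.

Lemma edist_ge0 p q : 0 <= edist p q.
Proof. exact: sqrtr_ge0. Qed.

Lemma edist_gt0 x y : x <> y -> 0 < edist x y.
Proof.
move=> xy; rewrite lt_neqAle edist_ge0 andbT eq_sym.
apply/eqP => e0; apply: xy.
have := edist_sqr x y; rewrite e0 expr0n /= => /esym/eqP.
rewrite paddr_eq0 ?sqr_ge0 // !sqrf_eq0 !subr_eq0 => /andP[/eqP h1 /eqP h2].
by case: x y h1 h2 {e0} => [? ?] [? ?] /= -> ->.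
Qed.

Lemma edist_le p q : edist p q <= `|p.1 - q.1| + `|p.2 - q.2|.
Proof.
rewrite -(@ler_pXn2r _ 2) ?nnegrE ?edist_ge0 ?addr_ge0 //.
rewrite edist_sqr -(real_normK (num_real (p.1 - q.1))).
rewrite -(real_normK (num_real (p.2 - q.2))) sqrrD.
by rewrite lerD2r lerDl mulrn_wge0 // mulr_ge0.
Qed.

Lemma norm_le_of_sqr (a b : R) : 0 <= b -> a ^+ 2 <= b ^+ 2 -> `|a| <= b.
Proof.
by move=> b0 ab; rewrite -(@ler_pXn2r _ 2) ?nnegrE // real_normK ?num_real.
Qed.

Lemma crossB x y p q : cross x y p - cross x y q =
  (y.1 - x.1) * (p.2 - q.2) - (y.2 - x.2) * (p.1 - q.1).
Proof. by rewrite /cross; ring. Qed.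

(** Cauchy--Schwarz for the direction rotated by a right angle. *)
Lemma cross_lip x y p q :
  `|cross x y p - cross x y q| <= edist p q * edist x y.
Proof.
apply: norm_le_of_sqr; first by rewrite mulr_ge0 // edist_ge0.
rewrite exprMn !edist_sqr crossB -subr_ge0.
rewrite [X in 0 <= X](_ : _ = ((y.1 - x.1) * (p.1 - q.1) + (y.2 - x.2) * (p.2 - q.2)) ^+ 2).
  exact: sqr_ge0.
by ring.
Qed.

(** The point [q] is the orthogonal projection of [p] on the line. *)
Lemma line_proj x y p : x <> y -> exists2 q,
  line_through x y q & edist p q * edist x y = `|cross x y p|.
Proof.
move=> xy; have e0 := edist_gt0 xy.
pose t := ((p.1 - x.1) * (y.1 - x.1) + (p.2 - x.2) * (y.2 - x.2)) / edist x y ^+ 2.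
exists (x.1 + t * (y.1 - x.1), x.2 + t * (y.2 - x.2)); first by exists t.
apply/eqP; rewrite -(@eqrXn2 _ 2) ?mulr_ge0 ?edist_ge0 //.
rewrite real_normK ?num_real // exprMn edist_sqr /=; apply/eqP.
have E2 : edist x y ^+ 2 != 0 by rewrite expf_neq0 // gt_eqF.
move: (edist_sqr x y) E2; rewrite /t /cross; move: (edist x y ^+ 2) => E -> E2.
by field.
Qed.

Lemma cross_line x y p : line_through x y p -> cross x y p = 0.
Proof. by move=> [t ->]; rewrite /cross /=; ring. Qed.

Lemma cross_eq0 x y p : x <> y -> cross x y p = 0 -> line_through x y p.
Proof.
move=> xy c0; have [q lq] := line_proj p xy.
rewrite c0 normr0 => /eqP; rewrite mulf_eq0 (gt_eqF (edist_gt0 xy)) orbF.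
have [-> //|/edist_gt0 /gt_eqF ->] := pselect (p = q); by [].
Qed.

Lemma tubeP x y r p : x <> y ->
  tube (line_through x y) r p <-> `|cross x y p| < r * edist x y.
Proof.
move=> xy; have e0 := edist_gt0 xy; split.
  move=> [q [lq pq]].
  rewrite -[X in `|X|]subr0 -(cross_line lq).
  by apply: le_lt_trans (cross_lip _ _ _ _) _; rewrite ltr_pM2r.
by have [q lq <-] := line_proj p xy; rewrite ltr_pM2r // => pq; exists q.
Qed.

(** The vectors [(a1, a2)] and [(- b2, b1)] are the unit normals of two lines
    whose angle has sine [a1 * b1 + a2 * b2] up to sign; Cramer's rule recovers
    [w] from its components along these normals. *)
Lemma transversal_coord_le (a1 a2 b1 b2 w1 w2 k : R) :
  a1 ^+ 2 + a2 ^+ 2 = 1 -> b1 ^+ 2 + b2 ^+ 2 = 1 ->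
  `|a1 * w1 + a2 * w2| <= k -> `|b1 * w2 - b2 * w1| <= k ->
  `|a1 * b1 + a2 * b2| * `|w1| <= 2 * k /\ `|a1 * b1 + a2 * b2| * `|w2| <= 2 * k.
Proof.
move=> ha hb h1 h2.
have u2 (c1 c2 : R) : c1 ^+ 2 + c2 ^+ 2 = 1 -> `|c1| <= 1 /\ `|c2| <= 1.
  move=> h; split; apply: norm_le_of_sqr => //.
    by rewrite expr1n -h lerDl sqr_ge0.
  by rewrite expr1n -h lerDr sqr_ge0.
have [a1' a2'] := u2 _ _ ha; have [b1' b2'] := u2 _ _ hb.
have k0 : 0 <= k by apply: le_trans h1.
have bd (c1 c2 e1 e2 : R) : `|c1| <= k -> `|e1| <= 1 -> `|c2| <= k -> `|e2| <= 1 ->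
    `|c1 * e1 + c2 * e2| <= 2 * k.
  move=> ? ? ? ?; apply: (le_trans (ler_normD _ _)); rewrite !normrM mulr_natl mulr2n.
  by apply: lerD; rewrite -[leRHS]mulr1; apply: ler_pM.
rewrite -!normrM; split.
  rewrite (_ : _ * w1 = (a1 * w1 + a2 * w2) * b1 + (b1 * w2 - b2 * w1) * - a2); last by ring.
  by apply: bd => //; rewrite normrN.
rewrite (_ : _ * w2 = (a1 * w1 + a2 * w2) * b2 + (b1 * w2 - b2 * w1) * a1); last by ring.
exact: bd.
Qed.

(** A point [o] of the second line at distance at least [D] from the first one,
    in a region of size [M], forces an angle of order at least [D / M] between
    the lines; the two tubes then meet in a set of diameter
    [O(d * M / D)]. *)
Lemma tubes_inter_diam M x y u v o z z' d D :
  x <> y -> u <> v -> 0 < d -> 4 * d <= D ->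
  [/\ `|o.1| <= M, `|o.2| <= M, `|z.1| <= M & `|z.2| <= M] ->
  cross u v o = 0 -> D * edist x y <= `|cross x y o| ->
  `|cross x y z| < d * edist x y -> `|cross x y z'| < d * edist x y ->
  `|cross u v z| < d * edist u v -> `|cross u v z'| < d * edist u v ->
  edist z z' * D <= 64 * M * d.
Proof.
move=> xy uv d0 dD [ho1 ho2 hz1 hz2] ouv Do xyz xyz' uvz uvz'.
have e0 := edist_gt0 xy; have f0 := edist_gt0 uv.
have exy := edist_sqr x y; have fuv := edist_sqr u v.
move: e0 exy Do xyz xyz'; set e := edist x y => e0 exy Do xyz xyz'.
move: f0 fuv uvz uvz'; set f := edist u v => f0 fuv uvz uvz'.
have D0 : 0 < D by lra.
pose a1 : R := - (y.2 - x.2) / e; pose a2 := (y.1 - x.1) / e.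
pose b1 := (v.1 - u.1) / f; pose b2 := (v.2 - u.2) / f.
have ne : e != 0 by rewrite gt_eqF.
have nf : f != 0 by rewrite gt_eqF.
have ha : a1 ^+ 2 + a2 ^+ 2 = 1.
  rewrite /a1 /a2 !exprMn !exprVn sqrrN -mulrDl exy.
  rewrite [X in X / _](_ : _ = e ^+ 2); last by rewrite exy; ring.
  by rewrite -exy divff // expf_neq0.
have hb : b1 ^+ 2 + b2 ^+ 2 = 1.
  rewrite /b1 /b2 !exprMn !exprVn -mulrDl fuv.
  rewrite [X in X / _](_ : _ = f ^+ 2); last by rewrite fuv; ring.
  by rewrite -fuv divff // expf_neq0.
have Ea p q : a1 * (p.1 - q.1) + a2 * (p.2 - q.2) = (cross x y p - cross x y q) / e.
  by rewrite crossB /a1 /a2; field.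
have Eb p q : b1 * (p.2 - q.2) - b2 * (p.1 - q.1) = (cross u v p - cross u v q) / f.
  by rewrite crossB /b1 /b2; field.
clearbody a1 a2 b1 b2.
have nrm (g c k : R) : 0 < g -> `|c| <= k * g -> `|c / g| <= k.
  by move=> g0 h; rewrite normrM normfV (gtr0_norm g0) ler_pdivrMr.
have dif (g c c' : R) : `|c| < d * g -> `|c'| < d * g -> `|c - c'| <= 2 * d * g.
  by move=> h h'; apply: (le_trans (ler_normB _ _)); lra.
have [h1 h2] : `|a1 * b1 + a2 * b2| * `|z.1 - z'.1| <= 2 * (2 * d) /\
    `|a1 * b1 + a2 * b2| * `|z.2 - z'.2| <= 2 * (2 * d).
  apply: transversal_coord_le => //.
    by rewrite Ea; apply: nrm => //; apply: dif.
  by rewrite Eb; apply: nrm => //; apply: dif.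
(* Up to an error d, z lies on the second line.  Going from there to o along
   this line changes the distance to the first one, which is less than d at z
   and at least D at o, by the sine of the angle times the length of the way,
   which is at most 4 * M. *)
have hs : D - 2 * d <= 4 * M * `|a1 * b1 + a2 * b2|.
  have l1 : D - d <= `|a1 * (o.1 - z.1) + a2 * (o.2 - z.2)|.
    rewrite Ea normrM normfV (gtr0_norm e0) ler_pdivlMr //.
    by have := lerB_dist (cross x y o) (cross x y z); rewrite mulrBl; lra.
  have E : a1 * (o.1 - z.1) + a2 * (o.2 - z.2) =
      (b1 * (o.1 - z.1) + b2 * (o.2 - z.2)) * (a1 * b1 + a2 * b2)
      + (b1 * (o.2 - z.2) - b2 * (o.1 - z.1)) * (a2 * b1 - a1 * b2).
    rewrite -[LHS]mul1r -hb; ring.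
  have lt : `|b1 * (o.1 - z.1) + b2 * (o.2 - z.2)| <= 4 * M.
    have q1 : `|b1| <= 1 by apply: norm_le_of_sqr => //; rewrite expr1n -hb lerDl sqr_ge0.
    have q2 : `|b2| <= 1 by apply: norm_le_of_sqr => //; rewrite expr1n -hb lerDr sqr_ge0.
    apply: (le_trans (ler_normD _ _)); rewrite !normrM.
    have r1 : `|b1| * `|o.1 - z.1| <= 1 * `|o.1 - z.1| by exact: ler_wpM2r.
    have r2 : `|b2| * `|o.2 - z.2| <= 1 * `|o.2 - z.2| by exact: ler_wpM2r.
    have r3 := ler_normB o.1 z.1; have r4 := ler_normB o.2 z.2; lra.
  have ls : `|b1 * (o.2 - z.2) - b2 * (o.1 - z.1)| <= d.
    by rewrite Eb; apply: nrm => //; rewrite ouv sub0r normrN ltW.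
  have lq : `|a2 * b1 - a1 * b2| <= 1.
    apply: norm_le_of_sqr => //; rewrite expr1n -[leRHS]mulr1 -{1}ha -hb -subr_ge0.
    rewrite [X in 0 <= X](_ : _ = (a1 * b1 + a2 * b2) ^+ 2); first exact: sqr_ge0.
    by ring.
  have := ler_normD ((b1 * (o.1 - z.1) + b2 * (o.2 - z.2)) * (a1 * b1 + a2 * b2))
    ((b1 * (o.2 - z.2) - b2 * (o.1 - z.1)) * (a2 * b1 - a1 * b2)).
  rewrite -E [in X in _ <= X + _]normrM [in X in _ <= _ + X]normrM.
  have w1 := ler_wpM2r (normr_ge0 (a1 * b1 + a2 * b2)) lt.
  have := ler_pM (normr_ge0 _) (normr_ge0 _) ls lq.
  lra.
have M0 : 0 <= M by apply: le_trans ho1.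
have fin (c : R) : 0 <= c -> `|a1 * b1 + a2 * b2| * c <= 2 * (2 * d) -> c * D <= 32 * M * d.
  move=> c0 hc; have := ler_wpM2l c0 hs; have := ler_wpM2l M0 hc.
  have := ler_wpM2l c0 dD; nra.
have := fin _ (normr_ge0 _) h1; have := fin _ (normr_ge0 _) h2.
have := ler_wpM2r (ltW D0) (edist_le z z'); rewrite mulrDl; lra.
Qed.

End Plane.

(** * Open sets and compact sets of the plane *)

Section PlaneTopology.
Context {R : realType}.
Implicit Types (p q : R * R) (r : R).

(** Open sets are countable unions of boxes with rational corners, hence
    belong to the product sigma-algebra. *)
Lemma open_measurable_plane (U : set (R * R)) : open U -> measurable U.
Proof.
move=> oU.
pose box (a b c e : rat) : set (R * R) :=
  `]ratr a, ratr b[%classic `*` `]ratr c, ratr e[%classic.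
pose F a b c e := if `[< box a b c e `<=` U >] then box a b c e else set0.
have -> : U = \bigcup_a \bigcup_b \bigcup_c \bigcup_e F a b c e.
  apply/seteqP; split => [p Up|p [a _ [b _ [c _ [e _]]]]]; last first.
    by rewrite /F; case: ifPn => // /asboolP; apply.
  have : nbhs p U by move: oU; rewrite openE; exact.
  move=> /nbhs_ballP[r /= r0 rU].
  have lm (t : R) : t - r < t by lra.
  have lp (t : R) : t < t + r by lra.
  have [a /[!in_itv]/= /andP[a1 a2]] := rat_in_itvoo (lm p.1).
  have [b /[!in_itv]/= /andP[b1 b2]] := rat_in_itvoo (lp p.1).
  have [c /[!in_itv]/= /andP[c1 c2]] := rat_in_itvoo (lm p.2).
  have [e /[!in_itv]/= /andP[e1 e2]] := rat_in_itvoo (lp p.2).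
  exists a => //; exists b => //; exists c => //; exists e => //.
  rewrite /F ifT; first by split => /=; rewrite in_itv /= ?a2 ?b1 ?c2 ?e1.
  apply/asboolP => -[q1 q2] /= []; rewrite /= !in_itv /= => /andP[? ?] /andP[? ?].
  apply: rU; split; rewrite /ball /= ltr_norml; apply/andP; split; lra.
do 4!(apply: bigcupT_measurable_rat => ?).
rewrite /F; case: ifP => // _; apply: measurableX; exact: measurable_itv.
Qed.

Lemma continuous_edistl (q : R * R) : continuous (fun p => edist p q).
Proof.
move=> p; apply: continuous_comp; last exact: sqrt_continuous.
by apply: cvgD; apply: cvgM; apply: cvgB;
  first [exact: cvg_fst | exact: cvg_snd | exact: cvg_cst].
Qed.

Lemma open_eball (q : R * R) r : open (eball q r).
Proof.
rewrite (_ : eball q r = (fun p => edist p q) @^-1` [set t | t < r]); last first.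
  by apply/seteqP; split => p; rewrite /eball /= edistC.
by apply: open_comp; [move=> p _; exact: continuous_edistl | exact: open_lt].
Qed.

Lemma open_tube (l : set (R * R)) r : open (tube l r).
Proof.
rewrite (_ : tube l r = \bigcup_(q in l) eball q r).
  by apply: bigcup_open => q _; exact: open_eball.
by apply/seteqP; split => p [q]; rewrite /eball /=;
  [move=> [lq] | move=> lq]; rewrite edistC; exists q.
Qed.

Lemma compact_measurable_plane (E : set (R * R)) : compact E -> measurable E.
Proof.
move=> /(compact_closed (@norm_hausdorff _ _)) cE.
rewrite -(setCK E); apply: measurableC; apply: open_measurable_plane.
exact: closed_openC.
Qed.

Lemma bounded_plane (E : set (R * R)) : compact E ->
  exists M : R, forall p, E p -> `|p.1| <= M /\ `|p.2| <= M.
Proof.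
move=> /compact_bounded [M [_ hM]]; exists (M + 1) => p Ep.
have M1 : M < M + 1 by rewrite ltrDl.
have := hM (M + 1) M1 p Ep.
by rewrite /= /Num.norm /= ge_max => /andP[].
Qed.

Lemma measurable_tube (l : set (R * R)) r : measurable (tube l r).
Proof. by apply: open_measurable_plane; exact: open_tube. Qed.

Lemma tube_subset (l : set (R * R)) r r' : r <= r' -> tube l r `<=` tube l r'.
Proof. by move=> rr' p [q [lq pq]]; exists q; split => //; exact: lt_le_trans rr'. Qed.

Lemma le_tube (P : probability (R * R)%type R) (l : set (R * R)) r r' : r <= r' ->
  (P (tube l r) <= P (tube l r'))%E.
Proof.
move=> rr'; apply: le_measure; rewrite ?inE; try exact: measurable_tube.
exact: tube_subset.
Qed.

Lemma open_setX (A B : set (R * R)) : open A -> open B -> open (A `*` B).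
Proof.
move=> oA oB.
rewrite (_ : A `*` B = (fst @^-1` A) `&` (snd @^-1` B)) //.
apply: openI; apply: open_comp => // z _; [exact: cvg_fst | exact: cvg_snd].
Qed.

End PlaneTopology.

(** * Measures of finite and countable families *)

Section Measures.
Context {R : realType} {dp : measure_display} {T : measurableType dp}.

Lemma full_measure_setI (mu : probability T R) (K A : set T) :
  measurable K -> measurable A -> mu K = 1%E -> mu A = mu (A `&` K).
Proof.
move=> mK mA K1; apply/eqP; rewrite eq_le; apply/andP; split; last first.
  by apply: le_measure; rewrite ?inE //; exact: measurableI.
have mC : measurable (~` K) by exact: measurableC.
have AE : A = (A `&` K) `|` (A `&` ~` K) by rewrite -setIUr setUv setIT.
apply: (@le_trans _ _ (mu (A `&` K) + mu (A `&` ~` K))%E).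
  by rewrite {1}AE; apply: measureU2; exact: measurableI.
rewrite -[leRHS]adde0; apply: leeD => //.
have : (mu (~` K) <= 0)%E by rewrite probability_setC // K1 subee.
by apply: le_trans; apply: le_measure; rewrite ?inE //; exact: measurableI.
Qed.

Lemma measure_bigsetU_card_le (P : {measure set T -> \bar R})
    (I : eqType) (s : seq I) (V : I -> set T) (a : R) :
  (forall i, measurable (V i)) -> (forall i, i \in s -> P (V i) <= a%:E)%E ->
  (P (\big[setU/set0]_(i <- s) V i) <= ((size s)%:R * a)%:E)%E.
Proof.
move=> mV; elim: s => [|i s IH] h.
  by rewrite big_nil measure0 /= mul0r.
rewrite big_cons.
have mU : measurable (\big[setU/set0]_(i <- s) V i) by apply: bigsetU_measurable.
apply: (@le_trans _ _ (P (V i) + P (\big[setU/set0]_(i <- s) V i))%E).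
  exact: measureU2.
rewrite [size _]/= -nat1r mulrDl mul1r EFinD; apply: leeD.
  by apply: h; rewrite mem_head.
by apply: IH => j js; apply: h; rewrite inE js orbT.
Qed.

Lemma setD_bigcup_gt0 (P : {measure set T -> \bar R})
    (A : set T) (W : nat -> set T) :
  measurable A -> (forall k, measurable (W k)) -> P A = 1%E ->
  (forall k, P (W k) <= ((1 / 2) / (2 ^ k.+1)%:R)%:E)%E ->
  (0 < P (A `&` ~` \bigcup_k W k))%E.
Proof.
move=> mA mW A1 hW.
have mU : measurable (\bigcup_k W k) by exact: bigcupT_measurable.
have mG : measurable (A `&` ~` \bigcup_k W k).
  by apply: measurableI => //; exact: measurableC.
have hU : (P (\bigcup_k W k) <= (1 / 2)%:E)%E.
  apply: le_trans (measure_sigma_subadditive P mW mU _) _; first by [].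
  have e : (\sum_(0 <= i <oo) ((1 / 2 : R) / (2 ^ i.+1)%:R)%:E <= (1 / 2 : R)%:E)%E.
    by apply: epsilon_trick0; rewrite divr_ge0.
  apply: le_trans e; apply: lee_nneseries => // k _; exact: hW.
rewrite ltNge; apply/negP => hG.
have : (P A <= P (A `&` ~` \bigcup_k W k) + P (\bigcup_k W k))%E.
  apply: (@le_trans _ _ (P ((A `&` ~` \bigcup_k W k) `|` \bigcup_k W k))); last first.
    exact: measureU2.
  apply: le_measure; rewrite ?inE //; first exact: measurableU.
  by move=> x Ax; have [|] := pselect ((\bigcup_k W k) x); [right|left].
rewrite A1 => /le_trans /(_ (leeD hG hU)); rewrite add0e lee_fin; lra.
Qed.

Lemma measure_setI_bigsetU_le (P : probability T R) (I : eqType) (s : seq I)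
    (A : set T) (S : I -> set T) (rho : R) :
  measurable A -> (forall i, measurable (S i)) ->
  (forall i, i \in s -> P (A `&` S i) <= rho%:E)%E ->
  (P (A `&` \big[setU/set0]_(i <- s) S i) <= ((size s)%:R * rho)%:E)%E.
Proof.
move=> mA mS h; rewrite (big_morph (setI A) (setIUr A) (setI0 A)).
by apply: measure_bigsetU_card_le => // i; exact: measurableI.
Qed.

(** As long as the sets [V x] of the points chosen so far miss some point of
    [B], choose that point.  By inclusion-exclusion, [n] sets of mass at least
    [m] with overlaps at most [rho] have a union of mass at least
    [n * m - n ^ 2 * rho].  This exceeds 1 when [2 < n * m <= 3] and
    [8 * rho <= m ^ 2], so the choice stops before, with a cover. *)
Lemma greedy_cover (P : probability T R) (X : choiceType) (B : set X)
    (S : X -> set T) (V : X -> set X) (m rho : R) :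
  0 < m <= 1 -> 0 <= rho -> 8 * rho <= m ^+ 2 -> (forall x, measurable (S x)) ->
  (forall x, B x -> m%:E <= P (S x))%E ->
  (forall x y, B x -> B y -> ~ V x y -> P (S x `&` S y) <= rho%:E)%E ->
  exists s : seq X, [/\ forall x, x \in s -> B x, (size s)%:R * m <= 3
    & B `<=` \big[setU/set0]_(x <- s) V x].
Proof.
move=> /andP[m0 m1] r0 rm mS mB hI.
pose U (s : seq X) := \big[setU/set0]_(x <- s) S x.
have mU s : measurable (U s) by apply: bigsetU_measurable.
have claim n : (exists s : seq X, [/\ forall x, x \in s -> B x, (size s <= n)%N
      & B `<=` \big[setU/set0]_(x <- s) V x]) \/
    exists s : seq X, [/\ forall x, x \in s -> B x, size s = n
      & n%:R * m - n%:R ^+ 2 * rho <= fine (P (U s))].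
  elim: n => [|n [[s [sB sn cov]]|[s [sB sn hs]]]].
  - right; exists [::]; split => //.
    by rewrite expr0n /= !mul0r subr0 fine_ge0 // measure_ge0.
  - by left; exists s; split => //; exact: leqW.
  have [cov|] := pselect (B `<=` \big[setU/set0]_(x <- s) V x).
    by left; exists s; split => //; rewrite sn.
  move=> /existsNP[x /not_implyP[Bx nx]]; right; exists (x :: s); split.
  + by move=> y; rewrite inE => /predU1P[->|/sB].
  + by rewrite /= sn.
  rewrite /U big_cons -/(U s).
  have rI : (P (S x `&` U s) <= (n%:R * rho)%:E)%E.
    rewrite -sn; apply: measure_setI_bigsetU_le => // y ys.
    rewrite setIC; apply: hI => //; first exact: sB.
    move=> Vyx; apply: nx; by rewrite -bigcup_seq; exists y.
  rewrite measureUfinl ?ltey_eq ?fin_num_measure //.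
  have mSU : measurable (S x `&` U s) by exact: measurableI.
  rewrite fineB ?fineD ?fin_numD ?fin_num_measure //.
  have h1 : m <= fine (P (S x)) by rewrite -lee_fin fineK ?fin_num_measure ?mB.
  have h2 : fine (P (S x `&` U s)) <= n%:R * rho.
    by rewrite -lee_fin fineK ?fin_num_measure.
  have nr0 : 0 <= n%:R * rho by rewrite mulr_ge0.
  rewrite -natr1; lra.
(* An n with 2 < n * m <= 3, where the lower bound of the claim exceeds 1. *)
pose n := (Num.truncn (2 / m)).+1.
have n2 : 2 < n%:R * m by rewrite -ltr_pdivrMr // truncnS_gt.
have n3 : n%:R * m <= 3.
  rewrite /n -natr1 mulrDl mul1r.
  have : (Num.truncn (2 / m))%:R * m <= 2.
    by rewrite -ler_pdivlMr // truncn_le // divr_ge0 // ltW.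
  lra.
have [[s [sB sn cov]]|[s [sB sn hs]]] := claim n.
  exists s; split => //; apply: le_trans n3; rewrite ler_pM2r // ler_nat //.
exfalso.
have : fine (P (U s)) <= 1.
  by rewrite -lee_fin fineK ?fin_num_measure // probability_le1.
have : n%:R ^+ 2 * (8 * rho) <= n%:R ^+ 2 * m ^+ 2 by rewrite ler_wpM2l // sqr_ge0.
move: hs; rewrite -exprMn; move: n2 n3; move: (n%:R * m) => t *; nra.
Qed.

End Measures.

(** * Thin tubes have uniformly small mass *)

Section NullLines.
Context {R : realType}.
Implicit Types (p q x y u v : R * R) (r M d D : R).

(** Each of the two products in [cross] is perturbed by at most
    [2 * eta * 2 * M + 2 * M * eta]. *)
Lemma cross_near M eta x y x' y' p :
  `|x.1| <= M -> `|x.2| <= M -> `|y.1| <= M -> `|y.2| <= M ->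
  `|x'.1| <= M -> `|x'.2| <= M -> `|y'.1| <= M -> `|y'.2| <= M ->
  `|p.1| <= M -> `|p.2| <= M ->
  `|x.1 - x'.1| <= eta -> `|x.2 - x'.2| <= eta ->
  `|y.1 - y'.1| <= eta -> `|y.2 - y'.2| <= eta ->
  `|cross x y p - cross x' y' p| <= 12 * M * eta.
Proof.
move=> hx1 hx2 hy1 hy2 hx1' hx2' hy1' hy2' hp1 hp2 ex1 ex2 ey1 ey2.
have M0 : 0 <= M by apply: le_trans hx1.
have e0 : 0 <= eta by apply: le_trans ex1.
have mulb (a b a' b' : R) : `|a - a'| <= 2 * eta -> `|b| <= 2 * M -> `|a'| <= 2 * M ->
    `|b - b'| <= eta -> `|a * b - a' * b'| <= 6 * M * eta.
  move=> h1 h2 h3 h4; rewrite (_ : _ - _ = (a - a') * b + a' * (b - b')); last by ring.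
  apply: (le_trans (ler_normD _ _)); rewrite !normrM.
  have k1 := ler_pM (normr_ge0 _) (normr_ge0 _) h1 h2.
  have k2 := ler_pM (normr_ge0 _) (normr_ge0 _) h3 h4.
  lra.
have sb (a b c : R) : `|a| <= c -> `|b| <= c -> `|a - b| <= 2 * c.
  by move=> h1 h2; apply: (le_trans (ler_normB _ _)); lra.
have sd (a b a' b' : R) : `|a - a'| <= eta -> `|b - b'| <= eta ->
    `|(a - b) - (a' - b')| <= 2 * eta.
  by move=> h1 h2; rewrite (_ : _ - (a' - b') = (a - a') - (b - b')); [exact: sb|ring].
have se (a b b' : R) : `|b - b'| <= eta -> `|(a - b) - (a - b')| <= eta.
  by move=> h; rewrite (_ : _ - (a - b') = - (b - b')); [rewrite normrN|ring].
have s1 : `|(y.1 - x.1) * (p.2 - x.2) - (y'.1 - x'.1) * (p.2 - x'.2)| <= 6 * M * eta.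
  by apply: mulb; [exact: sd|exact: sb|exact: sb|exact: se].
have s2 : `|(y.2 - x.2) * (p.1 - x.1) - (y'.2 - x'.2) * (p.1 - x'.1)| <= 6 * M * eta.
  by apply: mulb; [exact: sd|exact: sb|exact: sb|exact: se].
rewrite /cross (_ : _ - _ = ((y.1 - x.1) * (p.2 - x.2) - (y'.1 - x'.1) * (p.2 - x'.2))
  - ((y.2 - x.2) * (p.1 - x.1) - (y'.2 - x'.2) * (p.1 - x'.1))); last by ring.
by have := ler_normB ((y.1 - x.1) * (p.2 - x.2) - (y'.1 - x'.1) * (p.2 - x'.2))
  ((y.2 - x.2) * (p.1 - x.1) - (y'.2 - x'.2) * (p.1 - x'.1)); lra.
Qed.

Lemma edist_le_of_coord M x y :
  `|x.1| <= M -> `|x.2| <= M -> `|y.1| <= M -> `|y.2| <= M ->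
  edist x y <= 4 * M.
Proof.
move=> *; apply: (le_trans (edist_le _ _)).
by have := ler_normB x.1 y.1; have := ler_normB x.2 y.2; lra.
Qed.

(** Continuity from above: a line is the decreasing intersection of its tubes. *)
Lemma null_line_thin (mu : probability (R * R)%type R) x y (eps : R) :
  x <> y -> mu (line_through x y) = 0%E -> 0 < eps ->
  exists2 h, 0 < h & exists2 A, measurable A /\ (mu A <= eps%:E)%E &
    forall p, `|cross x y p| < h -> A p.
Proof.
move=> xy l0 e0; have xy0 := edist_gt0 xy.
pose F (n : nat) := tube (line_through x y) n.+1%:R^-1.
have EF : \bigcap_n F n = line_through x y.
  apply/seteqP; split => p.
    move=> h; apply: cross_eq0 => //; apply/normr0_eq0/eqP/negPn/negP => c0.
    have {}c0 : 0 < `|cross x y p| / edist x y.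
      by rewrite divr_gt0 // lt_neqAle eq_sym c0 normr_ge0.
    have [n _ /(_ n (leqnn _)) /=] := near_infty_natSinv_lt (PosNum c0).
    have /tubeP := h n Logic.I => /(_ xy); rewrite -ltr_pdivrMr // => h1 h2.
    by have := lt_trans h1 h2; rewrite ltxx.
  move=> lp n _; apply/tubeP => //; rewrite cross_line // normr0 mulr_gt0 //.
have mF n : measurable (F n) by exact: measurable_tube.
have cv : mu \o F @ \oo --> mu (\bigcap_n F n).
  apply: nonincreasing_cvg_mu => //.
  - by apply: (@le_lt_trans _ _ 1%E); [exact: probability_le1 | rewrite ltry].
  - exact: bigcapT_measurable.
  - move=> n m nm; apply/subsetPset => p [q [lq pq]]; exists q; split => //.
    by apply: lt_le_trans pq _; rewrite lef_pV2 ?posrE // ler_nat.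
rewrite EF l0 in cv.
have : \forall n \near \oo, (mu (F n) < eps%:E)%E.
  apply: (cv [set u | (u < eps%:E)%E]); apply: open_nbhs_nbhs; split.
    exact: open_ereal_lt_ereal.
  by rewrite /= lte_fin.
move=> [n _ /(_ n (leqnn _)) /= hn].
exists (n.+1%:R^-1 * edist x y); first by rewrite mulr_gt0.
by exists (F n) => [|p hp]; [split => //; exact: ltW | apply/tubeP].
Qed.

(** Near a pair [(x, y)], a thin tube around the line through a nearby pair is,
    inside the compact set [K] that carries the measure, contained in a fixed
    neighborhood of the line through [x] and [y] of mass at most [eps];
    compactness of [E `*` F] makes the width uniform. *)
Lemma thin_tubes_uniform (mu : probability (R * R)%type R) (E F K : set (R * R)) (eps : R) :
  compact E -> compact F -> E `&` F = set0 -> compact K -> mu K = 1%E ->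
  (forall l, is_line l -> mu l = 0%E) -> 0 < eps ->
  exists2 h, 0 < h & forall x y d, E x -> F y -> 0 < d -> d < h ->
    (mu (tube (line_through x y) d) <= eps%:E)%E.
Proof.
move=> cE cF EF0 cK K1 l0 e0.
have ne x y : E x -> F y -> x <> y.
  move=> Ex Fy xy; have : (E `&` F) x by split => //; rewrite xy.
  by rewrite EF0.
have [ME hME] := bounded_plane cE.
have [MF hMF] := bounded_plane cF.
have [MK hMK] := bounded_plane cK.
pose M := Num.max 1 (Num.max ME (Num.max MF MK)).
have M0 : 0 < M by rewrite /M lt_max ltr01.
have mono (A : set (R * R)) B : (forall p, A p -> `|p.1| <= B /\ `|p.2| <= B) -> B <= M ->
    forall p, A p -> `|p.1| <= M /\ `|p.2| <= M.
  by move=> h BM p /h [h1 h2]; split; apply: le_trans BM.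
have {}hME := mono _ _ hME _; have {}hMF := mono _ _ hMF _; have {}hMK := mono _ _ hMK _.
have {}hME := hME ltac:(by rewrite /M !le_max lexx !orbT).
have {}hMF := hMF ltac:(by rewrite /M !le_max lexx !orbT).
have {}hMK := hMK ltac:(by rewrite /M !le_max lexx !orbT).
have mK := compact_measurable_plane cK.
have : \forall i \near 0^'+, E `*` F `<=`
    [set z | (mu (tube (line_through z.1 z.2) i) <= eps%:E)%E].
  have /compact_near_coveringP/near_covering_withinP cEF := compact_setX cE cF.
  apply: cEF => -[x y] [/= Ex Fy].
  have xy := ne _ _ Ex Fy.
  have lxy : is_line (line_through x y) by exists x, y.
  have [h h0 [A [mA muA] hA]] := null_line_thin xy (l0 _ lxy) e0.
  (* Perturbing the pair by eta changes cross by at most 12 * M * eta = h / 2; a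
     tube of width i contributes at most i * (4 * M) < h / 2. *)
  pose eta := h / (24 * M).
  have eta0 : 0 < eta by rewrite divr_gt0 // mulr_gt0.
  near=> z i => -[/= Ez Fz].
  have zz := ne _ _ Ez Fz.
  have i0 : 0 < i by near: i; exact: nbhs_right_gt.
  have ih : i < h / (8 * M) by near: i; apply: nbhs_right_lt; rewrite divr_gt0 // mulr_gt0.
  have : ball (x, y) eta z by near: z; exact: nbhsx_ballx.
  move=> [[b1 b2] [b3 b4]].
  rewrite (full_measure_setI mK) //; last exact: measurable_tube.
  apply: le_trans muA; apply: le_measure; rewrite ?inE //.
    by apply: measurableI => //; exact: measurable_tube.
  move=> p [/(tubeP _ _ zz) tp Kp]; apply: hA.
  have [? ?] := hME _ Ex; have [? ?] := hMF _ Fy.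
  have [? ?] := hME _ Ez; have [? ?] := hMF _ Fz; have [? ?] := hMK _ Kp.
  have c1 : `|cross x y p - cross z.1 z.2 p| <= 12 * M * eta.
    by apply: cross_near => //; exact: ltW.
  have c2 : i * edist z.1 z.2 <= i * (4 * M).
    by rewrite ler_pM2l //; exact: edist_le_of_coord.
  have c3 : i * (8 * M) < h by rewrite -ltr_pdivlMr // mulr_gt0.
  have c4 : eta * (24 * M) = h by rewrite /eta divfK // gt_eqF // mulr_gt0.
  have := ler_normD (cross x y p - cross z.1 z.2 p) (cross z.1 z.2 p); rewrite subrK.
  lra.
move=> [h /= h0 hh]; exists h => // x y d Ex Fy d0 dh.
apply: (hh d _ d0 (x, y)) => //=.
by rewrite sub0r normrN gtr0_norm.
Unshelve. all: by end_near.
Qed.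

End NullLines.

(** * One step from a scale to the next *)

Section OneStep.
Context {R : realType}.
Implicit Types (p q x y u v : R * R) (r M d D : R).

(** For [r <= 1] a smaller exponent weakens the bound; for [1 <= r] the bound
    is at least 1. *)
Lemma eball_frostman_min (P : probability (R * R)%type R) (c c' s s' : R) :
  0 < s -> s <= s' -> c' <= c -> 1 <= c ->
  (forall p r, 0 < r -> (P (eball p r) <= (c' * r `^ s')%:E)%E) ->
  forall p r, 0 < r -> (P (eball p r) <= (c * r `^ s)%:E)%E.
Proof.
move=> s0 ss' cc c1 hP p r r0.
have [r1|/ltW r1] := leP r 1.
  apply: le_trans (hP p r r0) _; rewrite lee_fin.
  apply: (@le_trans _ _ (c * r `^ s')); first by rewrite ler_wpM2r ?powR_ge0.
  by rewrite ler_wpM2l ?(le_trans ler01 c1) // ger_powR // r0.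
apply: (@le_trans _ _ 1%E).
  by apply: probability_le1; apply: open_measurable_plane; exact: open_eball.
rewrite lee_fin -[leLHS]mulr1; apply: ler_pM => //.
by rewrite -(powRr0 r) ler_powR // ltW.
Qed.

(** By [tubes_inter_diam] the part of the intersection that carries mass lies in
    one ball; 65 replaces 64 because balls are open. *)
Lemma tubes_inter_measure (P : probability (R * R)%type R) (K : set (R * R))
    (M d D c s : R) x y u v :
  compact K -> P K = 1%E ->
  (forall p, K p -> `|p.1| <= M /\ `|p.2| <= M) ->
  0 < M -> 0 < c -> 0 < d -> 4 * d <= D ->
  (forall p r, 0 < r -> (P (eball p r) <= (c * r `^ s)%:E)%E) ->
  x <> y -> u <> v -> (`|u.1| <= M /\ `|u.2| <= M) -> (`|v.1| <= M /\ `|v.2| <= M) ->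
  ~ (tube (line_through x y) D u /\ tube (line_through x y) D v) ->
  (P (tube (line_through x y) d `&` tube (line_through u v) d)
     <= (c * (65 * M * d / D) `^ s)%:E)%E.
Proof.
move=> cK K1 bK M0 c0 d0 dD frost xy uv bu bv sep.
have D0 : 0 < D by lra.
have mK := compact_measurable_plane cK.
set A := _ `&` _.
have mA : measurable A by apply: measurableI; exact: measurable_tube.
rewrite (full_measure_setI mK mA K1).
have [->|/set0P[z [[/(tubeP _ _ xy) z1 /(tubeP _ _ uv) z2] Kz]]] := eqVneq (A `&` K) set0.
  by rewrite measure0 lee_fin mulr_ge0 ?powR_ge0 // ltW.
have r0 : 0 < 65 * M * d / D by rewrite divr_gt0 // !mulr_gt0.
apply: le_trans (frost z _ r0); apply: le_measure; rewrite ?inE.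
- exact: measurableI.
- by apply: open_measurable_plane; exact: open_eball.
move=> p [[/(tubeP _ _ xy) p1 /(tubeP _ _ uv) p2] Kp]; rewrite /eball /= edistC ltr_pdivlMr //.
have [bz1 bz2] := bK _ Kp.
have [w [[bo1 bo2] oc Do]] : exists w, [/\ `|w.1| <= M /\ `|w.2| <= M, cross u v w = 0
    & D * edist x y <= `|cross x y w|].
  have [tu|ntu] := pselect (tube (line_through x y) D u).
    exists v; split => //; first by rewrite /cross; ring.
    by rewrite leNgt; apply/negP => h; apply: sep; split => //; apply/tubeP.
  exists u; split => //; first by rewrite /cross; ring.
  by rewrite leNgt; apply/negP => h; apply: ntu; apply/tubeP.
have := tubes_inter_diam xy uv d0 dD (And4 bo1 bo2 bz1 bz2) oc Do p1 z1 p2 z2.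
by move=> h; apply: le_lt_trans h _; rewrite !ltr_pM2r // ltr_nat.
Qed.

(** The pairs that are good at scale [D] with threshold [m0], but have a [d]-tube
    of [P]-mass above [m1], are covered greedily by products of [D]-tubes.  The
    pairs taken in the cover are themselves good at scale [D], so each product
    has mass at most [m0 ^ 2]. *)
Lemma heavy_tubes_cover (mu nu P : probability (R * R)%type R) (E F K : set (R * R))
    (M d D c s m0 m1 : R) :
  (forall x y, E x -> F y -> x <> y) -> compact K -> P K = 1%E ->
  (forall p, E p -> `|p.1| <= M /\ `|p.2| <= M) ->
  (forall p, F p -> `|p.1| <= M /\ `|p.2| <= M) ->
  (forall p, K p -> `|p.1| <= M /\ `|p.2| <= M) ->
  0 < M -> 0 < c -> 0 < d -> 4 * d <= D ->
  (forall p r, 0 < r -> (P (eball p r) <= (c * r `^ s)%:E)%E) ->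
  0 <= m0 -> 0 < m1 <= 1 -> 8 * (c * (65 * M * d / D) `^ s) <= m1 ^+ 2 ->
  exists W : set ((R * R) * (R * R)), [/\ open W, measurable W,
    ((mu \x nu) W <= (3 * m0 ^+ 2 / m1)%:E)%E &
    forall x y, E x -> F y -> 
      (mu (tube (line_through x y) D) <= m0%:E)%E ->
      (nu (tube (line_through x y) D) <= m0%:E)%E ->
      ~ W (x, y) -> (P (tube (line_through x y) d) <= m1%:E)%E].
Proof.
move=> ne cK K1 bE bF bK M0 c0 d0 dD frost hm0 hm1 hrho.
have /andP[m1gt0 _] := hm1.
pose S (z : (R * R) * (R * R)) := tube (line_through z.1 z.2) d.
pose V (z : (R * R) * (R * R)) :=
  tube (line_through z.1 z.2) D `*` tube (line_through z.1 z.2) D.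
pose B := [set z : (R * R) * (R * R) | [/\ E z.1, F z.2,
  (mu (tube (line_through z.1 z.2) D) <= m0%:E)%E,
  (nu (tube (line_through z.1 z.2) D) <= m0%:E)%E & (m1%:E <= P (S z))%E]].
have mV z : measurable (V z) by apply: measurableX; exact: measurable_tube.
have rho0 : 0 <= c * (65 * M * d / D) `^ s by rewrite mulr_ge0 ?powR_ge0 // ltW.
have mS z : measurable (S z) by exact: measurable_tube.
have hB z : B z -> (m1%:E <= P (S z))%E by case.
have hI z w : B z -> B w -> ~ V z w ->
    (P (S z `&` S w) <= (c * (65 * M * d / D) `^ s)%:E)%E.
  move=> [Ez Fz _ _ _] [Ew Fw _ _ _] nV.
  by apply: (tubes_inter_measure (K := K)) => //; [exact: ne|exact: ne|exact: bE|exact: bF].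
have [s0 [sB ss cov]] := greedy_cover hm1 rho0 hrho mS hB hI.
exists (\big[setU/set0]_(z <- s0) V z); split.
- rewrite -bigcup_seq; apply: bigcup_open => z _.
  by apply: open_setX; exact: open_tube.
- by apply: bigsetU_measurable.
- apply: (@le_trans _ _ ((size s0)%:R * m0 ^+ 2)%:E).
    apply: measure_bigsetU_card_le => // z /sB [_ _ h1 h2 _].
    rewrite [leLHS](_ : _ = (mu (tube (line_through z.1 z.2) D)
        * nu (tube (line_through z.1 z.2) D))%E); last first.
      by apply: product_measure1E; exact: measurable_tube.
    rewrite expr2 EFinM; exact: lee_pmul.
  by rewrite lee_fin ler_pdivlMr // mulrAC ler_wpM2r // sqr_ge0.
- move=> x y Ex Fy h1 h2 nW; rewrite leNgt; apply/negP => h3; apply: nW.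
  by apply: cov; split => //; exact: ltW.
Qed.

End OneStep.

(** * Scales and thresholds *)

Section Scales.
Context {R : realType}.

Lemma bernoulli_ineq (t : R) (n : nat) : 0 <= t -> 1 + n%:R * t <= (1 + t) ^+ n.
Proof.
move=> t0; elim: n => [|n IH]; first by rewrite mul0r addr0 expr0.
have n0 : 0 <= n%:R * t by rewrite mulr_ge0.
have t1 : 0 <= 1 + t by lra.
rewrite exprSr; apply: le_trans (ler_wpM2r t1 IH); rewrite -natr1; nra.
Qed.

Lemma expR_nat_ge (n : nat) : 2 ^+ n <= expR (n%:R : R).
Proof.
have -> : (n%:R : R) = n%:R * 1 by rewrite mulr1.
rewrite expRM_natl lerXn2r ?nnegrE ?expR_ge0 //.
by have := expR_ge1Dx (1 : R); lra.
Qed.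

(** With [p k = (5/4) ^ k] and [b k = min ((6/5) ^ k, Q)], take
    [d k = eps ^ (Q * p k / tau)] and [m k = eps ^ (p k * b k)].  Thus
    [d k ^ tau = eps ^ (Q * p k) <= m k], with equality once [Q <= (6/5) ^ k],
    and [m k.+1 >= m k ^ (3/2)] since [5/4 * 6/5 = 3/2].  The free parameter [Q]
    makes [d 0] as small as required without changing [m 0 = eps].
    In the overlap bound, [(d k.+1 / d k) ^ s = d k ^ (s / 4)] has to be small
    against [m k.+1 ^ 2 >= d k ^ (5/2 * tau)], whence [tau = s / 20]; and
    [d k ^ tau = d k.+1 ^ kappa] for [kappa = 4/5 * tau].  In the proof
    [eps = expR (- L)]. *)
Lemma exists_scales (s : R) : 0 < s -> exists2 kappa : R, 0 < kappa &
  forall c A : R, 0 < c -> 0 < A -> exists2 eps : R, 0 < eps &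
  forall h : R, 0 < h -> exists (d m : nat -> R) (C : R),
  [/\ 0 < C, m 0%N = eps & d 0%N < h] /\
  [/\ forall k, 0 < d k, forall k, 4 * d k.+1 <= d k, forall k, 0 < m k <= 1 &
  [/\ forall k, 8 * (c * (A * d k.+1 / d k) `^ s) <= m k.+1 ^+ 2,
      forall k, 12 * m k ^+ 2 / m k.+1 <= (2 ^+ k.+1)^-1 &
      forall k, m k <= C * d k.+1 `^ kappa]].
Proof.
move=> s0; pose tau := s / 20.
have pow_ge (q : R) k : 5 * q <= k%:R -> q <= (6 / 5) ^+ k.
  move=> qk; have := bernoulli_ineq k (_ : 0 <= 1 / 5).
  rewrite (_ : 1 + 1 / 5 = 6 / 5 :> R); last by lra.
  by move=> /(_ ltac:(lra)); apply: le_trans; lra.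
have tau0 : 0 < tau by rewrite divr_gt0.
exists (4 / 5 * tau); first by rewrite mulr_gt0 // divr_gt0.
(* The three terms of L serve respectively to sum the losses, to have
   4 * d k.+1 <= d k, and to absorb the constants c and A. *)
move=> c A c0 A0.
pose L := 16 + 8 * tau + `|ln (8 * (c * A `^ s))|.
have Ln := normr_ge0 (ln (8 * (c * A `^ s))).
have Labs : 16 + 8 * tau + `|ln (8 * (c * A `^ s))| <= L by [].
clearbody L.
have L16 : 16 <= L by lra.
have L0 : 0 < L by lra.
exists (expR (- L)) => [|h h0]; first exact: expR_gt0.
pose Q := 1 + `|ln h|.
have Q1 : 1 <= Q by rewrite /Q lerDl.
pose p (k : nat) : R := (5 / 4) ^+ k.
pose b (k : nat) : R := Num.min ((6 / 5) ^+ k) Q.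
pose a := L * Q / tau.
have p_ge k : 1 + k%:R / 4 <= p k.
  have := bernoulli_ineq k (_ : 0 <= 1 / 4).
  rewrite (_ : 1 + 1 / 4 = 5 / 4 :> R); last by lra.
  by move=> /(_ ltac:(lra)); rewrite -/(p k); lra.
have p1 k : 1 <= p k by have := p_ge k; have : 0 <= k%:R :> R := ler0n _ _; lra.
have pS k : p k.+1 = 5 / 4 * p k by rewrite /p exprS.
have bQ k : b k <= Q by rewrite /b ge_min lexx orbT.
have b1 k : 1 <= b k by rewrite /b le_min Q1 andbT exprn_ege1 //; lra.
have bS k : b k.+1 <= 6 / 5 * b k.
  rewrite /b exprS minr_pMr; last by lra.
  rewrite le_min !ge_min lexx /=; apply/orP; right; lra.
have atau : a * tau = L * Q by rewrite /a divfK // gt_eqF.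
have a_ge : 8 * Q <= a.
  by rewrite /a ler_pdivlMr //; nra.
clearbody a.
have pb k : Q <= p k * Q by have := p1 k; nra.
have p0 : p 0%N = 1 by [].
have b0 : b 0%N = 1 by rewrite /b expr0; apply/min_idPl.
have [N bN] : exists N, forall k, (N <= k)%N -> b k = Q.
  exists (Num.truncn (5 * Q)).+1 => k Nk; apply/min_idPr; apply: pow_ge.
  by apply: ltW; apply: lt_le_trans (truncnS_gt _) _; rewrite ler_nat.
have pmono j k : (j <= k)%N -> p j <= p k.
  by move=> jk; rewrite /p ler_weXn2l //; lra.
clearbody p b.
exists (fun k => expR (- (a * p k))), (fun k => expR (- (L * (p k * b k)))).
have exp2 : 4 <= expR 2 :> R.
  by have := expR_nat_ge 2; rewrite expr2; lra.
exists (expR (L * Q * p N)); split; split.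
- exact: expR_gt0.
- by rewrite p0 b0 !mulr1.
- rewrite p0 mulr1 -[ltRHS]lnK ?posrE // ltr_expR.
  have := ler_norm (- ln h); rewrite normrN; have : `|ln h| = Q - 1 by rewrite /Q; ring.
  lra.
- by move=> k; exact: expR_gt0.
- move=> k.
  rewrite (_ : - (a * p k) = - (a * p k.+1) + a * p k / 4); last by rewrite pS; field.
  rewrite expRD mulrC ler_wpM2l ?expR_ge0 //; apply: le_trans exp2 _.
  rewrite ler_expR; have := p1 k; nra.
- move=> k; rewrite expR_gt0 -[leRHS]expR0 ler_expR oppr_le0 /=.
  have := p1 k; have := b1 k => ? ?; rewrite !mulr_ge0 //; lra.
split.
- move=> k.
  have -> : A * expR (- (a * p k.+1)) / expR (- (a * p k)) = A * expR (- (a * p k / 4)).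
    by rewrite -expRN -mulrA -expRD pS; congr (_ * expR _); field.
  rewrite powRM ?expR_ge0 ?(ltW A0) // -expRM !mulrA -[8 * c * _]mulrA.
  rewrite -[X in X * _]lnK ?posrE ?mulr_gt0 ?powR_gt0 //.
  rewrite -expRD -expRM_natl ler_expR.
  have := ler_norm (ln (8 * (c * A `^ s))).
  have : - (a * p k / 4) * s = - (5 * (L * Q * p k)) by rewrite -atau /tau; field.
  have LQ0 : 0 <= L * Q by rewrite mulr_ge0 //; lra.
  have : L * Q <= L * Q * p k by rewrite ler_peMr.
  have : L * (p k.+1 * b k.+1) <= 5 / 4 * (L * Q * p k).
    rewrite pS [leLHS](_ : _ = 5 / 4 * (L * p k * b k.+1)); last by field.
    rewrite ler_pM2l; last by lra.
    by rewrite [leRHS]mulrAC ler_wpM2l // mulr_ge0 //; have := p1 k; lra.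
  have : L <= L * Q by rewrite ler_peMr // ltW.
  lra.
- move=> k.
  rewrite -expRM_natl -expRN -mulrA -expRD.
  have LX : L * p k <= L * (p k * b k).
    by rewrite ler_pM2l // ler_peMr //; have := p1 k; lra.
  have LY : L * (p k.+1 * b k.+1) <= 3 / 2 * (L * (p k * b k)).
    rewrite pS [leRHS](_ : _ = L * (5 / 4 * p k * (6 / 5 * b k))); last by field.
    by rewrite ler_pM2l // ler_wpM2l //; have := p1 k; lra.
  have k0 : 0 <= k%:R :> R by exact: ler0n.
  have LZ : 16 * (1 + k%:R / 4) <= L * p k.
    by apply: ler_pM => //; lra.
  have : expR (2 * - (L * (p k * b k)) - - (L * (p k.+1 * b k.+1))) <= (2 ^+ (k + 6))^-1.
    apply: (@le_trans _ _ (expR (- (k + 6)%:R))).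
      rewrite ler_expR natrD; lra.
    rewrite expRN lef_pV2 ?posrE ?expR_gt0 ?exprn_gt0 //.
    exact: expR_nat_ge.
  move=> h1; apply: le_trans (ler_wpM2l _ h1) _ => //.
  rewrite -ler_pdivlMl // -invfM lef_pV2 ?posrE ?mulr_gt0 ?exprn_gt0 //.
  rewrite exprD exprS; have : 0 < 2 ^+ k :> R by rewrite exprn_gt0.
  lra.
- move=> k; rewrite -expRM -expRD ler_expR.
  have -> : - (a * p k.+1) * (4 / 5 * tau) = - (L * Q * p k).
    by rewrite -atau pS; field.
  have LQ0 : 0 <= L * Q by rewrite mulr_ge0 //; lra.
  (* After rank N the bound holds without the constant; before it, the factor
     expR (L * Q * p N) makes the right-hand side at least 1. *)
  have [Nk|/ltnW kN] := leqP N k.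
    rewrite bN //.
    rewrite [L * (_ * _)](_ : _ = L * Q * p k); last by ring.
    by rewrite lerDr mulr_ge0 //; have := p1 N; lra.
  have := ler_wpM2l LQ0 (pmono _ _ kN).
  have : 0 <= L * (p k * b k).
    by rewrite !mulr_ge0 //; have := p1 k; have := b1 k; lra.
  lra.
Qed.

Lemma scale_bracket (d : nat -> R) r :
  (forall k, 0 < d k) -> (forall k, 4 * d k.+1 <= d k) -> 0 < r -> r < d 0%N ->
  exists k, d k.+1 <= r < d k.
Proof.
move=> d0 d4 r0 rd.
have dk k : k.+1%:R * d k <= d 0%N.
  elim: k => [|k IH]; first by rewrite mul1r.
  apply: le_trans IH; have := d4 k; have := d0 k.+1; rewrite -!natr1.
  have : 0 <= k%:R :> R by []. nra.
have ex : exists n, d n <= r.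
  exists (Num.truncn (d 0%N / r)); rewrite leNgt; apply/negP => h.
  have := dk (Num.truncn (d 0%N / r)); apply/negP; rewrite -ltNge.
  apply: (@lt_trans _ _ ((Num.truncn (d 0%N / r)).+1%:R * r)).
    by rewrite -ltr_pdivrMr // truncnS_gt.
  by rewrite ltr_pM2l.
case: (ex_minnP ex) => -[|k] hk kmin; first by move: rd; rewrite ltNge hk.
exists k; rewrite hk ltNge; apply/negP => /kmin; by rewrite ltnn.
Qed.

(** A width between [d k.+1] and [d k] is treated as [d k], which is why the
    hypothesis compares [m k] with [d k.+1]; widths above [d 0] use the bound
    by 1. *)
Lemma thin_of_scales (P : probability (R * R)%type R) (d m : nat -> R) (C kappa : R)
    (l : set (R * R)) :
  0 < C -> 0 < kappa -> (forall k, 0 < d k) -> (forall k, 4 * d k.+1 <= d k) ->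
  (forall k, m k <= C * d k.+1 `^ kappa) ->
  (forall k, (P (tube l (d k)) <= (m k)%:E)%E) ->
  forall r, 0 < r -> (P (tube l r) <= ((C + d 0%N `^ (- kappa)) * r `^ kappa)%:E)%E.
Proof.
move=> C0 k0 d0 d4 mC hm r r0.
have pw t : 0 <= t `^ kappa by move=> *; exact: powR_ge0.
rewrite mulrDl; have [dr|rd] := leP (d 0%N) r.
  apply: (@le_trans _ _ 1%E); first by apply: probability_le1; exact: measurable_tube.
  rewrite lee_fin -[leLHS]add0r; apply: lerD; first by rewrite mulr_ge0 // ltW.
  rewrite powRN mulrC ler_pdivlMr ?powR_gt0 // mul1r.
  by rewrite ge0_ler_powR ?nnegrE // ltW.
have [k /andP[kr rk]] := scale_bracket d0 d4 r0 rd.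
apply: le_trans (le_tube _ _ (ltW rk)) _; apply: le_trans (hm k) _; rewrite lee_fin.
apply: le_trans (mC k) _; rewrite -[leLHS]addr0; apply: lerD; last first.
  by rewrite mulr_ge0 // powR_ge0.
by rewrite ler_pM2l // ge0_ler_powR ?nnegrE // ltW.
Qed.

End Scales.

Theorem proposition6p1 (R : realType) (s_mu s_nu : R)
    (s_mu_gt0 : 0 < s_mu) (s_mu_le2 : s_mu <= 2)
    (s_nu_gt0 : 0 < s_nu) (s_nu_le2 : s_nu <= 2) :
  exists kappa : R, 0 < kappa /\
  forall (mu nu : probability (R * R)%type R) (E F : set (R * R))
         (c_mu c_nu : R),
    compact E -> compact F -> E `&` F = set0 ->
    mu E = 1%E -> nu F = 1%E ->
    (forall l : set (R * R), is_line l -> mu l = 0%E /\ nu l = 0%E) ->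
    0 < c_mu -> 0 < c_nu ->
    (forall (x : R * R) (r : R), 0 < r ->
       (mu (eball x r) <= (c_mu * r `^ s_mu)%:E)%E /\
       (nu (eball x r) <= (c_nu * r `^ s_nu)%:E)%E) ->
  exists (G : set ((R * R) * (R * R))) (C : R),
    [/\ compact G,
        G `<=` E `*` F,
        (0 < (mu \x nu) G)%E,
        0 < C
      & forall x y : R * R, G (x, y) ->
        forall r : R, 0 < r ->
          (mu (tube (line_through x y) r) <= (C * r `^ kappa)%:E)%E /\
          (nu (tube (line_through x y) r) <= (C * r `^ kappa)%:E)%E].
Proof.
pose s := Num.min s_mu s_nu.
have s0 : 0 < s by rewrite lt_min s_mu_gt0.
have [kappa kappa0 scales] := exists_scales s0.
exists kappa; split => // mu nu E F c_mu c_nu cE cF EF0 muE nuF lines0 c_mu0 c_nu0 frost.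
pose c := Num.max 1 (Num.max c_mu c_nu).
have c1 : 1 <= c by rewrite le_max lexx.
have c0 : 0 < c by apply: lt_le_trans c1.
have frost_mu p r : 0 < r -> (mu (eball p r) <= (c * r `^ s)%:E)%E.
  apply: (@eball_frostman_min _ mu c c_mu s s_mu) => //; first by rewrite ge_min lexx.
    by rewrite !le_max lexx !orbT.
  by move=> q t t0; case: (frost q t t0).
have frost_nu p r : 0 < r -> (nu (eball p r) <= (c * r `^ s)%:E)%E.
  apply: (@eball_frostman_min _ nu c c_nu s s_nu) => //; first by rewrite ge_min lexx orbT.
    by rewrite !le_max lexx !orbT.
  by move=> q t t0; case: (frost q t t0).
have ne x y : E x -> F y -> x <> y.
  move=> Ex Fy xy; have : (E `&` F) x by split => //; rewrite xy.
  by rewrite EF0.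
have [ME hME] := bounded_plane cE; have [MF hMF] := bounded_plane cF.
pose M := Num.max 1 (Num.max ME MF).
have M0 : 0 < M by rewrite lt_max ltr01.
have bE p : E p -> `|p.1| <= M /\ `|p.2| <= M.
  by move=> /hME[? ?]; rewrite !le_max; split; apply/orP; right; apply/orP; left.
have bF p : F p -> `|p.1| <= M /\ `|p.2| <= M.
  by move=> /hMF[? ?]; rewrite !le_max; split; apply/orP; right; apply/orP; right.
have A0 : 0 < 65 * M by rewrite mulr_gt0.
have [eps eps0 {}scales] := scales c (65 * M) c0 A0.
have mu_line l : is_line l -> mu l = 0%E by case/lines0.
have nu_line l : is_line l -> nu l = 0%E by case/lines0.
have [h1 h10 thin_mu] := thin_tubes_uniform cE cF EF0 cE muE mu_line eps0.
have [h2 h20 thin_nu] := thin_tubes_uniform cE cF EF0 cF nuF nu_line eps0.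
have h0 : 0 < Num.min h1 h2 by rewrite lt_min h10.
have [d [m [C [[C0 m0 dh] [d0 d4 m01 [mrho msum mC]]]]]] := scales _ h0.
move: dh; rewrite lt_min => /andP[dh1 dh2].
have Wex k : exists W : set ((R * R) * (R * R)), [/\ open W, measurable W,
    ((mu \x nu) W <= ((1 / 2) / (2 ^ k.+1)%:R)%:E)%E &
    forall x y, E x -> F y ->
      (mu (tube (line_through x y) (d k)) <= (m k)%:E)%E ->
      (nu (tube (line_through x y) (d k)) <= (m k)%:E)%E ->
      ~ W (x, y) -> (mu (tube (line_through x y) (d k.+1)) <= (m k.+1)%:E)%E /\
        (nu (tube (line_through x y) (d k.+1)) <= (m k.+1)%:E)%E].
  have mk0 : 0 <= m k by case/andP: (m01 k) => /ltW.
  have [W1 [opn1 me1 le1 hW1]] := heavy_tubes_cover mu nu ne cE muE bE bF bE M0 c0 (d0 k.+1)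
    (d4 k) frost_mu mk0 (m01 k.+1) (mrho k).
  have [W2 [opn2 me2 le2 hW2]] := heavy_tubes_cover mu nu ne cF nuF bE bF bF M0 c0 (d0 k.+1)
    (d4 k) frost_nu mk0 (m01 k.+1) (mrho k).
  (* The two losses add up to 6 * m k ^ 2 / m k.+1 <= 1 / 2 ^ (k + 2). *)
  exists (W1 `|` W2); split; [exact: openU|exact: measurableU| |].
    apply: (@le_trans _ _ ((mu \x nu) W1 + (mu \x nu) W2)%E); first exact: measureU2.
    apply: le_trans (leeD le1 le2) _.
    rewrite -EFinD lee_fin natrX; have := msum k.
    move: (m k ^+ 2) ((m k.+1)^-1) ((2 ^+ k.+1)^-1) => a b t.
    lra.
  move=> x y Ex Fy g1 g2 /not_orP[n1 n2]; split; [exact: hW1|exact: hW2].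
have [W hW] := choice Wex.
exists ((E `*` F) `&` ~` \bigcup_k W k), (C + d 0%N `^ (- kappa)); split.
- apply: compact_closedI; first exact: compact_setX.
  by apply: open_closedC; apply: bigcup_open => k _; case: (hW k).
- by move=> z [].
- have mE := compact_measurable_plane cE; have mF := compact_measurable_plane cF.
  apply: setD_bigcup_gt0; first exact: measurableX.
  + by move=> k; case: (hW k).
  + transitivity (mu E * nu F)%E; first exact: product_measure1E.
    by rewrite muE nuF mule1.
  + by move=> k; case: (hW k).
- by rewrite ltr_pwDl // powR_ge0.
- move=> x y [[/= Ex Fy] nW].
  have good k : (mu (tube (line_through x y) (d k)) <= (m k)%:E)%E /\
      (nu (tube (line_through x y) (d k)) <= (m k)%:E)%E.
    elim: k => [|k [g1 g2]]; first by rewrite m0; split; [exact: thin_mu|exact: thin_nu].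
    case: (hW k) => _ _ _; apply => //.
    by move=> Wk; apply: nW; exists k.
  by move=> r r0; split; apply: (thin_of_scales C0 kappa0 d0 d4 mC) => // k; case: (good k).
Qed.
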